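(* Let $\mathscr{A}$ be an abelian category with a projective class $\mathscr{P}$, $\mathscr{B}$ an abelian category, and $T:\mathscr{A}\to\mathscr{B}$ an additive (covariant) functor. Suppose $\mathscr{P}$ is closed or, more generally, is closed with respect to retracts. Then there are isomorphisms $$L_n^{\square}T(A)\cong L_nT(A),\quad A\in\mathscr{A},\ n\ge0,$$ natural in $A$ and $T$, where $L_n^{\square}T$ are the cubical left derived functors of $T$ and $L_nT$ are the left derived functors of $T$ in the sense of Eilenberg–Moore, both with respect to $\mathscr{P}$.
   Context: Given a class $\mathscr{P}$ of objects of $\mathscr{A}$, a morphism $f: B\to B'$ is $\mathscr{P}$-epimorphic if $\mathrm{Hom}_{\mathscr{A}}(Q,f)$ is surjective for all $Q\in\mathscr{P}$. $\mathscr{P}$ is a projective class if for each object $B$ there is a $\mathscr{P}$-epimorphic $e: Q\to B$ with $Q\in\mathscr{P}$. $\mathscr{P}$ is closed (Eilenberg–Moore) if it contains every object $Q$ such that $\mathrm{Hom}_{\mathscr{A}}(Q,f)$ is surjective for every $\mathscr{P}$-epimorphic $f$; it is closed with respect to retracts if every retract of an object of $\mathscr{P}$ lies in $\mathscr{P}$. Eilenberg–Moore derived functors: a $\mathscr{P}$-projective resolution of $A$ in the sense of Eilenberg–Moore is an augmented nonnegative chain complex $\cdots\to C_1\to C_0\to A\to0$ with all $C_n\in\mathscr{P}$ such that applying $\mathrm{Hom}_{\mathscr{A}}(Q,-)$ gives an exact sequence of abelian groups for each $Q\in\mathscr{P}$; then $L_nT(A)=H_n(T(C_* ))$. Cubical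 derived functors: a precubical object $X$ in a category is a family of objects $(X_n)_{n\ge 0}$ with face morphisms $\partial_i^0,\partial_i^1: X_n\to X_{n-1}$ ($1\le i\le n$) satisfying $\partial_i^\alpha\partial_j^\varepsilon=\partial_{j-1}^\varepsilon\partial_i^\alpha$ for $i<j$, $\alpha,\varepsilon\in\{0,1\}$. An augmented precubical object $X\xrightarrow{\partial}A$ is a precubical object $X$ with an object $A$ and a morphism $\partial: X_0\to A$ such that $\partial\partial_1^0=\partial\partial_1^1$. A cubical kernel of morphisms $f_1^0,\dots,f_n^0,f_1^1,\dots,f_n^1: B\to C$ ($n\ge1$) is a sequence $k_1^0,\dots,k_{n+1}^0,k_1^1,\dots,k_{n+1}^1: K\to B$ with $f_i^\omega k_j^\alpha=f_{j-1}^\alpha k_i^\omega$ for $1\le i<j\le n+1$, $\omega,\alpha\in\{0,1\}$, which is universal: for any sequence $h_1^0,\dots,h_{n+1}^0,h_1^1,\dots,h_{n+1}^1: D\to B$ satisfying the same identities there is a unique $h: D\to K$ with $k_i^\omega h=h_i^\omega$ for all $i,\omega$. For $X\xrightarrow{\partial}A$, let $k_1^0,k_1^1: K_1\to X_0$ be the kernel pair of $\partial$ and, for $n\ge2$, let $k_1^0,\dots,k_n^0,k_1^1,\dots,k_n^1: K_n\to X_{n-1}$ be a cubical kernel of the faces $(\partial_1^0,\dots,\partial_{n-1}^0,\partial_1^1,\dots,\partial_{n-1}^1): X_{n-1}\to X_{n-2}$; let $e_n: X_n\to K_n$ be the unique morphism with $k_i^\varepsilon e_n=\partial_i^\varepsilon$.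 Then $X\xrightarrow{\partial}A$ is a $\mathscr{P}$-projective precubical resolution of $A$ if every $X_n\in\mathscr{P}$ ($n\ge0$) and $\partial$ and all $e_n$ ($n\ge1$) are $\mathscr{P}$-epimorphic. Every object has one. For a precubical object $X$ in an abelian category, $N(X)$ is the chain complex with $N_0(X)=X_0$, $N_n(X)=\bigcap_{i=1}^n\ker\partial_i^1$ ($n>0$) and differential $\sum_{i=1}^n(-1)^{i+1}\partial_i^0$. $L_n^{\square}T(A)=H_n(N(T(P)))$, where $P\to A$ is a chosen $\mathscr{P}$-projective precubical resolution of $A$ and $T(P)$ is obtained by applying $T$ degreewise; on a morphism $f: A\to A'$, $L_n^{\square}T(f)$ is induced by any precubical morphism (family commuting with faces) $\overline f=(f_n): P\to P'$ of the chosen resolutions with $f\partial=\partial'f_0$. This is well defined, independent of choices up to natural isomorphism, and functorial in $T$. *)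

(* Defs.v *)
From mathcomp Require Import all_boot all_algebra.
From mathcomp Require Import boolp classical_sets.

Set Implicit Arguments.
Unset Strict Implicit.
Unset Printing Implicit Defensive.
Import GRing.Theory.
Local Open Scope ring_scope.

Declare Scope cat_scope.
Delimit Scope cat_scope with cat.

(* The choice structure that [zmodType] puts on the groups of morphisms is no
   restriction classically: every type has one. *)
Record preadditive_cat := Preadditive {
  obj :> Type;
  mor : obj -> obj -> zmodType;
  idm : forall X, mor X X;
  mcomp : forall X Y Z, mor Y Z -> mor X Y -> mor X Z;
  comp_idl : forall X Y (f : mor X Y), mcomp (idm Y) f = f;
  comp_idr : forall X Y (f : mor X Y), mcomp f (idm X) = f;
  compA : forall X Y Z W (h : mor Z W) (g : mor Y Z) (f : mor X Y),
    mcomp h (mcomp g f) = mcomp (mcomp h g) f;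
  compDl : forall X Y Z (g g' : mor Y Z) (f : mor X Y),
    mcomp (g + g') f = mcomp g f + mcomp g' f;
  compDr : forall X Y Z (g : mor Y Z) (f f' : mor X Y),
    mcomp g (f + f') = mcomp g f + mcomp g f' }.

Arguments idm {p} X.
Arguments mcomp {p X Y Z} g f.

Notation "g ∘ f" := (mcomp g f) (at level 40, left associativity) : cat_scope.
Open Scope cat_scope.

Section Basics.
Context {C : preadditive_cat}.
Implicit Types X Y Z D K Q : C.

Definition is_iso X Y (f : mor X Y) : Prop :=
  exists g : mor Y X, g ∘ f = idm X /\ f ∘ g = idm Y.

Definition mono X Y (f : mor X Y) : Prop :=
  forall D (u v : mor D X), f ∘ u = f ∘ v -> u = v.

Definition epi X Y (f : mor X Y) : Prop :=
  forall D (u v : mor Y D), u ∘ f = v ∘ f -> u = v.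

Definition is_zero Z : Prop :=
  forall X, (forall f g : mor X Z, f = g) /\ (forall f g : mor Z X, f = g).

Definition is_kernel X Y K (f : mor X Y) (k : mor K X) : Prop :=
  f ∘ k = 0 /\
  forall D (h : mor D X), f ∘ h = 0 -> exists! u : mor D K, k ∘ u = h.

Definition is_cokernel X Y Q (f : mor X Y) (q : mor Y Q) : Prop :=
  q ∘ f = 0 /\
  forall D (h : mor Y D), h ∘ f = 0 -> exists! u : mor Q D, u ∘ q = h.

Definition is_biproduct X Y S (i1 : mor X S) (i2 : mor Y S)
    (p1 : mor S X) (p2 : mor S Y) : Prop :=
  [/\ p1 ∘ i1 = idm X, p2 ∘ i2 = idm Y, p1 ∘ i2 = 0, p2 ∘ i1 = 0
    & i1 ∘ p1 + i2 ∘ p2 = idm S].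

End Basics.

Record abelian_cat := Abelian {
  ab_cat :> preadditive_cat;
  zero_ex : exists Z : ab_cat, is_zero Z;
  biproduct_ex : forall X Y : ab_cat, exists (S : ab_cat)
    (i1 : mor X S) (i2 : mor Y S) (p1 : mor S X) (p2 : mor S Y),
    is_biproduct i1 i2 p1 p2;
  kernel_ex : forall (X Y : ab_cat) (f : mor X Y),
    exists (K : ab_cat) (k : mor K X), is_kernel f k;
  cokernel_ex : forall (X Y : ab_cat) (f : mor X Y),
    exists (Q : ab_cat) (q : mor Y Q), is_cokernel f q;
  mono_normal : forall (X Y : ab_cat) (m : mor X Y), mono m ->
    exists (Z : ab_cat) (g : mor Y Z), is_kernel g m;
  epi_normal : forall (X Y : ab_cat) (e : mor X Y), epi e ->
    exists (W : ab_cat) (g : mor W X), is_cokernel g e }.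

Record add_functor (C D : preadditive_cat) := AddFunctor {
  fobj :> C -> D;
  fmap : forall X Y : C, mor X Y -> mor (fobj X) (fobj Y);
  fmap_id : forall X : C, fmap (idm X) = idm (fobj X);
  fmap_comp : forall (X Y Z : C) (g : mor Y Z) (f : mor X Y),
    fmap (g ∘ f) = fmap g ∘ fmap f;
  fmapD : forall (X Y : C) (f g : mor X Y), fmap (f + g) = fmap f + fmap g }.

Arguments fmap {C D} T {X Y} f : rename.

Record nat_trans (C D : preadditive_cat) (T T' : add_functor C D) := NatTrans {
  ntc :> forall X : C, mor (T X) (T' X);
  ntP : forall (X Y : C) (f : mor X Y), ntc Y ∘ fmap T f = fmap T' f ∘ ntc X }.

Section ProjectiveClass.
Context {C : preadditive_cat} (P : C -> Prop).

Definition hom_surj (Q B B' : C) (f : mor B B') : Prop :=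
  forall g : mor Q B', exists h : mor Q B, f ∘ h = g.

Definition P_epi (B B' : C) (f : mor B B') : Prop :=
  forall Q, P Q -> hom_surj Q f.

Definition projective_class : Prop :=
  forall B, exists (Q : C) (e : mor Q B), P Q /\ P_epi e.

Definition closed_class : Prop :=
  forall Q, (forall (B B' : C) (f : mor B B'), P_epi f -> hom_surj Q f) -> P Q.

Definition is_retract (X Y : C) : Prop :=
  exists (s : mor X Y) (r : mor Y X), r ∘ s = idm X.

Definition retract_closed : Prop := forall X Y, P Y -> is_retract X Y -> P X.

End ProjectiveClass.

Section CompLemmas.
Context {C : preadditive_cat}.
Implicit Types X Y Z : C.

Lemma comp0r X Y Z (g : mor Y Z) : g ∘ (0 : mor X Y) = 0.
Proof. by apply: (addrI (g ∘ (0 : mor X Y))); rewrite -compDr !addr0. Qed.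

Lemma comp0l X Y Z (f : mor X Y) : (0 : mor Y Z) ∘ f = 0.
Proof. by apply: (addrI ((0 : mor Y Z) ∘ f)); rewrite -compDl !addr0. Qed.

Lemma compNl X Y Z (g : mor Y Z) (f : mor X Y) : (- g) ∘ f = - (g ∘ f).
Proof. by apply: (addrI (g ∘ f)); rewrite -compDl !subrr comp0l. Qed.

Lemma compNr X Y Z (g : mor Y Z) (f : mor X Y) : g ∘ (- f) = - (g ∘ f).
Proof. by apply: (addrI (g ∘ f)); rewrite -compDr !subrr comp0r. Qed.

Lemma comp_sumr X Y Z (g : mor Y Z) I (r : seq I) p (F : I -> mor X Y) :
  g ∘ (\sum_(i <- r | p i) F i) = \sum_(i <- r | p i) g ∘ F i.
Proof.
by apply: (big_morph (fun f => g ∘ f)) => [f f'|]; rewrite ?compDr ?comp0r.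
Qed.

Lemma comp_suml X Y Z I (r : seq I) p (G : I -> mor Y Z) (f : mor X Y) :
  (\sum_(i <- r | p i) G i) ∘ f = \sum_(i <- r | p i) G i ∘ f.
Proof.
by apply: (big_morph (fun g => g ∘ f)) => [g g'|]; rewrite ?compDl ?comp0l.
Qed.

Lemma comp_mulzr X Y Z (g : mor Y Z) (f : mor X Y) (z : int) :
  g ∘ (f *~ z) = (g ∘ f) *~ z.
Proof.
have natr n : g ∘ (f *+ n) = (g ∘ f) *+ n.
  by elim: n => [|n IH]; rewrite ?mulr0n ?comp0r // !mulrS compDr IH.
by case: z => n; rewrite ?NegzE ?mulrNz -!pmulrn ?compNr natr.
Qed.

Lemma comp_mulzl X Y Z (g : mor Y Z) (f : mor X Y) (z : int) :
  (g *~ z) ∘ f = (g ∘ f) *~ z.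
Proof.
have natl n : (g *+ n) ∘ f = (g ∘ f) *+ n.
  by elim: n => [|n IH]; rewrite ?mulr0n ?comp0l // !mulrS compDl IH.
by case: z => n; rewrite ?NegzE ?mulrNz -!pmulrn ?compNl natl.
Qed.

(* The morphism [u] with [m ∘ u = h]; it is unique when [m] is mono, and the
   value is the dummy 0 when there is none. Dually for [cofactor]. *)
Definition factor X Y Z (m : mor Y Z) (h : mor X Z) : mor X Y :=
  xget 0 (fun u => m ∘ u = h).

Definition cofactor X Y Z (q : mor X Y) (h : mor X Z) : mor Y Z :=
  xget 0 (fun u => u ∘ q = h).

Lemma factorP X Y Z (m : mor Y Z) (h : mor X Z) :
  (exists u, m ∘ u = h) -> m ∘ factor m h = h.
Proof. by move=> ex; apply: (@xgetPex _ 0 (fun u => m ∘ u = h)). Qed.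

Lemma cofactorP X Y Z (q : mor X Y) (h : mor X Z) :
  (exists u, u ∘ q = h) -> cofactor q h ∘ q = h.
Proof. by move=> ex; apply: (@xgetPex _ 0 (fun u => u ∘ q = h)). Qed.

Lemma is_kernel_mono X Y K (f : mor X Y) (k : mor K X) :
  is_kernel f k -> mono k.
Proof.
move=> [fk0 uk] D u v kuv.
have [|w [_ wP]] := uk D (k ∘ u); first by rewrite compA fk0 comp0l.
by rewrite -(wP u erefl) -(wP v (esym kuv)).
Qed.

End CompLemmas.

Record subobject (C : preadditive_cat) (X : C) := Subobject {
  sdom : C;
  sinc : mor sdom X;
  sinc_mono : mono sinc }.

Section Kernels.
Context {C : abelian_cat}.
Implicit Types X Y Z D : C.

Definition zero_obj : C := projT1 (cid (zero_ex C)).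

Definition kern X Y (f : mor X Y) : subobject X :=
  let (K, exk) := cid (kernel_ex f) in
  let (k, kP) := cid exk in Subobject (is_kernel_mono kP).

Lemma kerP X Y (f : mor X Y) : is_kernel f (sinc (kern f)).
Proof. by rewrite /kern; case: cid => K exk; case: cid. Qed.

Lemma comp_ker X Y (f : mor X Y) : f ∘ sinc (kern f) = 0.
Proof. by case: (kerP f). Qed.

Lemma ker_factor X Y D (f : mor X Y) (h : mor D X) :
  f ∘ h = 0 -> exists u, sinc (kern f) ∘ u = h.
Proof. by case: (kerP f) => _ /[apply] -[u [uP _]]; exists u. Qed.

Definition cokern_obj X Y (f : mor X Y) : C := projT1 (cid (cokernel_ex f)).

Definition cokern X Y (f : mor X Y) : mor Y (cokern_obj f) :=
  projT1 (cid (projT2 (cid (cokernel_ex f)))).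

Lemma cokerP X Y (f : mor X Y) : is_cokernel f (cokern f).
Proof. exact: (projT2 (cid (projT2 (cid (cokernel_ex f))))). Qed.

Definition full_sub X : subobject X.
Proof.
by exists X (idm X) => D u v; rewrite !comp_idl.
Defined.

Lemma sub_ker_mono X Y (s : subobject X) (f : mor X Y) :
  mono (sinc s ∘ sinc (kern (f ∘ sinc s))).
Proof.
by move=> D u v; rewrite -!compA => /sinc_mono /sinc_mono.
Qed.

Definition sub_ker X Y (s : subobject X) (f : mor X Y) : subobject X :=
  Subobject (sub_ker_mono (s := s) (f := f)).

(* [sub_ker s f] is the intersection of [s] with the kernel of [f], so that
   [cap_ker fs] is the intersection of the kernels of the members of [fs]; its
   universal property is [cap_ker_comp] and [cap_ker_factor]. *)
Fixpoint cap_ker X Y (fs : seq (mor X Y)) : subobject X :=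
  if fs is f :: fs' then sub_ker (cap_ker fs') f else full_sub X.

Lemma cap_ker_comp X Y (fs : seq (mor X Y)) f :
  f \in fs -> f ∘ sinc (cap_ker fs) = 0.
Proof.
elim: fs => //= g fs IH; rewrite inE => /orP[/eqP->|/IH f0].
  by rewrite compA comp_ker.
by rewrite compA f0 comp0l.
Qed.

Lemma cap_ker_factor X Y D (fs : seq (mor X Y)) (h : mor D X) :
  (forall f, f \in fs -> f ∘ h = 0) ->
  exists u, sinc (cap_ker fs) ∘ u = h.
Proof.
elim: fs => [|g fs IH] /= h0; first by exists h; rewrite comp_idl.
have [|u uP] := IH; first by move=> f ffs; apply: h0; rewrite inE ffs orbT.
have [|v vP] := @ker_factor _ _ _ (g ∘ sinc (cap_ker fs)) u.
  by rewrite -compA uP h0 // inE eqxx.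
by exists v; rewrite -compA vP.
Qed.

End Kernels.

Record chain_complex (C : preadditive_cat) := Complex {
  cobj :> nat -> C;
  cdiff : forall n, mor (cobj n.+1) (cobj n);
  cdiffK : forall n, cdiff n ∘ cdiff n.+1 = 0 }.

Record chain_map (C : preadditive_cat) (X Y : chain_complex C) := ChainMap {
  cmap :> forall n, mor (X n) (Y n);
  cmapP : forall n, cdiff Y n ∘ cmap n.+1 = cmap n ∘ cdiff X n }.

Section Homology.
Context {C : abelian_cat}.
Implicit Types X Y : chain_complex C.

(* The differential leaving degree [n], with [X_(-1) = 0]. *)
Definition cpred X (n : nat) : C := if n is m.+1 then X m else zero_obj.

Definition cdout X (n : nat) : mor (X n) (cpred X n) :=
  if n is m.+1 return mor (X n) (cpred X n) then cdiff X m else 0.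

Definition cycles X (n : nat) : subobject (X n) := kern (cdout X n).

Definition bound X (n : nat) : mor (X n.+1) (sdom (cycles X n)) :=
  factor (sinc (cycles X n)) (cdiff X n).

Definition homology X (n : nat) : C := cokern_obj (bound X n).

Definition cycles_map X Y (f : chain_map X Y) (n : nat) :
    mor (sdom (cycles X n)) (sdom (cycles Y n)) :=
  factor (sinc (cycles Y n)) (f n ∘ sinc (cycles X n)).

Definition homology_map X Y (f : chain_map X Y) (n : nat) :
    mor (homology X n) (homology Y n) :=
  cofactor (cokern (bound X n)) (cokern (bound Y n) ∘ cycles_map f n).

Lemma boundP X n : sinc (cycles X n) ∘ bound X n = cdiff X n.
Proof.
apply/factorP/ker_factor; case: n => [|n]; first exact: comp0l.
exact: cdiffK.
Qed.

Lemma cycles_mapP X Y (f : chain_map X Y) n :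
  sinc (cycles Y n) ∘ cycles_map f n = f n ∘ sinc (cycles X n).
Proof.
apply/factorP/ker_factor; case: n => [|n]; first exact: comp0l.
by rewrite /= compA cmapP -compA (comp_ker (cdiff X n)) comp0r.
Qed.

Lemma homology_mapP X Y (f : chain_map X Y) n :
  homology_map f n ∘ cokern (bound X n) = cokern (bound Y n) ∘ cycles_map f n.
Proof.
apply: cofactorP; have [_ uX] := cokerP (bound X n).
have [|u [uP _]] := uX _ (cokern (bound Y n) ∘ cycles_map f n); last by exists u.
rewrite -compA; have -> : cycles_map f n ∘ bound X n = bound Y n ∘ f n.+1.
  apply: (@sinc_mono _ _ (cycles Y n)).
  by rewrite compA cycles_mapP -compA boundP compA boundP cmapP.
by rewrite compA (proj1 (cokerP (bound Y n))) comp0l.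
Qed.

End Homology.

(* Indices are 0-based: [h i a] stands for h_(i+1)^a, with [false] and [true]
   for the superscripts 0 and 1. *)
Definition cubical_identities (C : preadditive_cat) (n : nat) (D X Y : C)
    (f : 'I_n.+1 -> bool -> mor X Y) (h : 'I_n.+2 -> bool -> mor D X) : Prop :=
  forall (i j : nat) (a e : bool), (i < j < n.+2)%N ->
    f (inord i) a ∘ h (inord j) e = f (inord j.-1) e ∘ h (inord i) a.

Record precubical (C : preadditive_cat) := Precubical {
  pobj :> nat -> C;
  face : forall n, 'I_n.+1 -> bool -> mor (pobj n.+1) (pobj n);
  faceP : forall n, cubical_identities (@face n) (@face n.+1) }.

Arguments face {C} X n i e : rename.

Record precubical_map (C : preadditive_cat) (X Y : precubical C) :=
  PrecubicalMap {
  pmap :> forall n, mor (X n) (Y n);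
  pmapP : forall n i e, face Y n i e ∘ pmap n.+1 = pmap n ∘ face X n i e }.

Definition is_cubical_kernel (C : preadditive_cat) (n : nat) (K X Y : C)
    (f : 'I_n.+1 -> bool -> mor X Y) (k : 'I_n.+2 -> bool -> mor K X) : Prop :=
  cubical_identities f k /\
  forall D (h : 'I_n.+2 -> bool -> mor D X), cubical_identities f h ->
    exists! u : mor D K, forall i e, k i e ∘ u = h i e.

Definition is_kernel_pair (C : preadditive_cat) (K X Y : C)
    (f : mor X Y) (k : bool -> mor K X) : Prop :=
  f ∘ k false = f ∘ k true /\
  forall D (h : bool -> mor D X), f ∘ h false = f ∘ h true ->
    exists! u : mor D K, forall e, k e ∘ u = h e.

Section Normalized.
Context {C : abelian_cat}.

Section Object.
Variable X : precubical C.

(* N_0 = X_0 and N_n = \bigcap_i ker ∂_i^1 for n > 0, as subobjects of X_n. *)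
Definition nsub (n : nat) : subobject (X n) :=
  if n is m.+1 return subobject (X n)
  then cap_ker [seq face X m i true | i : 'I_m.+1] else full_sub (X 0).

Definition alt_face (n : nat) : mor (X n.+1) (X n) :=
  \sum_(i < n.+1) face X n i false *~ (-1) ^+ i.

Definition norm_obj (n : nat) : C := sdom (nsub n).

Definition norm_diff (n : nat) : mor (norm_obj n.+1) (norm_obj n) :=
  factor (sinc (nsub n)) (alt_face n ∘ sinc (nsub n.+1)).

Lemma face_nsub n (i : 'I_n.+1) : face X n i true ∘ sinc (nsub n.+1) = 0.
Proof. by apply: cap_ker_comp; apply: map_f; rewrite mem_enum. Qed.

Lemma nsub_factor n D (h : mor D (X n.+1)) :
  (forall i, face X n i true ∘ h = 0) -> exists u, sinc (nsub n.+1) ∘ u = h.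
Proof. by move=> h0; apply: cap_ker_factor => f /mapP[i _ ->]. Qed.

Lemma face_face_nsub n (i : 'I_n.+1) (j : 'I_n.+2) :
  face X n i true ∘ (face X n.+1 j false ∘ sinc (nsub n.+2)) = 0.
Proof.
rewrite compA; have [ij|ji] := ltnP i j.
  have /= := @faceP _ X n i j true false.
  rewrite ij ltn_ord !inord_val => /(_ isT).
  move=> ->; rewrite -compA.
  have -> : face X n.+1 (inord i) true ∘ sinc (nsub n.+2) = 0.
    exact: face_nsub.
  exact: comp0r.
have /= := @faceP _ X n j (i.+1) false true.
rewrite ltnS ji ltnS (ltn_ord i) inord_val => /(_ isT) E.
have {}E : face X n i true ∘ face X n.+1 j false
    = face X n (inord j) false ∘ face X n.+1 (inord i.+1) true.
  by rewrite E !inord_val.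
by rewrite E -compA face_nsub comp0r.
Qed.

Lemma norm_diffP n :
  sinc (nsub n) ∘ norm_diff n = alt_face n ∘ sinc (nsub n.+1).
Proof.
apply: factorP; case: n => [|n].
  by exists (alt_face 0 ∘ sinc (nsub 1)); rewrite comp_idl.
apply: nsub_factor => i; rewrite comp_suml comp_sumr big1 // => j _.
by rewrite comp_mulzl comp_mulzr face_face_nsub mul0rz.
Qed.

Lemma alt_faceK n : alt_face n ∘ alt_face n.+1 = 0.
Proof.
rewrite comp_suml; under eq_bigr => i _ do rewrite comp_sumr.
rewrite pair_big /= (bigID (fun p : 'I_n.+1 * 'I_n.+2 => (p.1 < p.2)%N)) /=.
rewrite [X in _ + X](reindex_onto
  (fun p : 'I_n.+1 * 'I_n.+2 => (inord p.2.-1 : 'I_n.+1, inord p.1 : 'I_n.+2))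
  (fun p : 'I_n.+1 * 'I_n.+2 => (inord p.2 : 'I_n.+1, inord p.1.+1 : 'I_n.+2)))
  /=; last first.
  move=> [i j] /=; rewrite -leqNgt => ji.
  have jn : (j < n.+1)%N by apply: leq_ltn_trans ji _.
  have iK : (inord i.+1 : 'I_n.+2) = i.+1 :> nat by rewrite inordK // ltnS.
  have jK : (inord j : 'I_n.+1) = j :> nat by rewrite inordK.
  by rewrite iK jK /= !inord_val.
rewrite [X in _ + X](eq_bigl (fun p : 'I_n.+1 * 'I_n.+2 => (p.1 < p.2)%N)).
  rewrite -big_split big1 //= => -[i [[|j] jn]] //= ij.
  rewrite !comp_mulzl !comp_mulzr -!mulrzA.
  have /= := @faceP _ X n i (j.+1) false false.
  rewrite ij jn => /(_ isT); rewrite inord_val => E.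
  have -> : Ordinal jn = inord j.+1 by apply: val_inj; rewrite /= inordK.
  rewrite E -mulrzDr !inordK ?(leq_trans (ltn_ord i)) //.
  by rewrite exprS mulN1r mulNr (mulrC ((-1) ^+ i)) addNr mulr0z.
move=> [i j] /=; rewrite -leqNgt.
have iK : (inord i : 'I_n.+2) = i :> nat by rewrite inordK // ltnS ltnW.
have jK : (inord j.-1 : 'I_n.+1) = j.-1 :> nat.
  by rewrite inordK //; case: j => [[|j]].
rewrite iK jK inord_val; case: (ltnP i j) => [ij | ji].
  have j0 : (0 < j)%N by apply: leq_ltn_trans ij.
  by rewrite prednK // inord_val eqxx andbT -ltnS prednK.
apply/negP => /andP[ij /eqP[E]].
have : (inord j.-1.+1 : 'I_n.+2) = j.-1.+1 :> nat.
  by rewrite inordK // ltnS -jK.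
by rewrite E => jE; move: (leq_trans ji ij); rewrite [X in (X <= _)%N]jE ltnn.
Qed.

Lemma norm_diffK n : norm_diff n ∘ norm_diff n.+1 = 0.
Proof.
apply: (@sinc_mono _ _ (nsub n)).
by rewrite compA norm_diffP -compA norm_diffP compA alt_faceK comp0l comp0r.
Qed.

Definition normalized : chain_complex C := Complex norm_diffK.

End Object.

Section Map.
Variables (X Y : precubical C) (f : precubical_map X Y).

Definition norm_map_comp (n : nat) : mor (normalized X n) (normalized Y n) :=
  factor (sinc (nsub Y n)) (f n ∘ sinc (nsub X n)).

Lemma norm_map_compP n :
  sinc (nsub Y n) ∘ norm_map_comp n = f n ∘ sinc (nsub X n).
Proof.
apply: factorP; case: n => [|n].
  by exists (f 0 ∘ sinc (nsub X 0)); rewrite comp_idl.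
by apply: nsub_factor => i; rewrite compA pmapP -compA face_nsub comp0r.
Qed.

Lemma alt_face_map n : alt_face Y n ∘ f n.+1 = f n ∘ alt_face X n.
Proof.
rewrite comp_suml comp_sumr; apply: eq_bigr => i _.
by rewrite comp_mulzl comp_mulzr pmapP.
Qed.

Lemma norm_map_compC n :
  cdiff (normalized Y) n ∘ norm_map_comp n.+1
  = norm_map_comp n ∘ cdiff (normalized X) n.
Proof.
apply: (@sinc_mono _ _ (nsub Y n)).
rewrite /= compA norm_diffP -compA norm_map_compP compA alt_face_map.
by rewrite [RHS]compA norm_map_compP -[RHS]compA norm_diffP compA.
Qed.

Definition norm_map : chain_map (normalized X) (normalized Y) :=
  ChainMap norm_map_compC.

End Map.

End Normalized.

Section ApplyFunctor.
Context {C D : preadditive_cat}.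

Lemma fmap0 (T : add_functor C D) (X Y : C) : fmap T (0 : mor X Y) = 0.
Proof. by apply: (addrI (fmap T (0 : mor X Y))); rewrite -fmapD !addr0. Qed.

Section OneFunctor.
Variable T : add_functor C D.

Lemma fcdiffK (X : chain_complex C) n :
  fmap T (cdiff X n) ∘ fmap T (cdiff X n.+1) = 0.
Proof. by rewrite -fmap_comp cdiffK fmap0. Qed.

Definition fcomplex (X : chain_complex C) : chain_complex D :=
  Complex (cobj := fun n => T (X n)) (fcdiffK X).

Lemma fcmapP (X Y : chain_complex C) (f : chain_map X Y) n :
  cdiff (fcomplex Y) n ∘ fmap T (f n.+1) = fmap T (f n) ∘ cdiff (fcomplex X) n.
Proof. by rewrite /= -!fmap_comp cmapP. Qed.

Definition fchain_map (X Y : chain_complex C) (f : chain_map X Y) :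
    chain_map (fcomplex X) (fcomplex Y) :=
  ChainMap (X := fcomplex X) (Y := fcomplex Y) (cmap := fun n => fmap T (f n))
    (fcmapP f).

Lemma ffaceP (X : precubical C) n :
  cubical_identities (fun i e => fmap T (face X n i e))
                     (fun i e => fmap T (face X n.+1 i e)).
Proof. by move=> i j a e ij; rewrite -!fmap_comp faceP. Qed.

Definition fprecubical (X : precubical C) : precubical D :=
  Precubical (pobj := fun n => T (X n)) (ffaceP X).

Lemma fpmapP (X Y : precubical C) (f : precubical_map X Y) n i e :
  face (fprecubical Y) n i e ∘ fmap T (f n.+1)
  = fmap T (f n) ∘ face (fprecubical X) n i e.
Proof. by rewrite /= -!fmap_comp pmapP. Qed.

Definition fprecubical_map (X Y : precubical C) (f : precubical_map X Y) :
    precubical_map (fprecubical X) (fprecubical Y) :=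
  PrecubicalMap (X := fprecubical X) (Y := fprecubical Y)
    (pmap := fun n => fmap T (f n)) (fpmapP f).

End OneFunctor.

Section Transformation.
Variables (T T' : add_functor C D) (eta : nat_trans T T').

Lemma nt_cmapP (X : chain_complex C) n :
  cdiff (fcomplex T' X) n ∘ eta (X n.+1) = eta (X n) ∘ cdiff (fcomplex T X) n.
Proof. by rewrite /= ntP. Qed.

Definition nt_chain_map (X : chain_complex C) :
    chain_map (fcomplex T X) (fcomplex T' X) :=
  ChainMap (X := fcomplex T X) (Y := fcomplex T' X)
    (cmap := fun n => eta (X n)) (nt_cmapP X).

Lemma nt_pmapP (X : precubical C) n i e :
  face (fprecubical T' X) n i e ∘ eta (X n.+1)
  = eta (X n) ∘ face (fprecubical T X) n i e.
Proof. by rewrite /= ntP. Qed.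

Definition nt_precubical_map (X : precubical C) :
    precubical_map (fprecubical T X) (fprecubical T' X) :=
  PrecubicalMap (X := fprecubical T X) (Y := fprecubical T' X)
    (pmap := fun n => eta (X n)) (nt_pmapP X).

End Transformation.

End ApplyFunctor.

Definition exact_hom (C : preadditive_cat) (Q X Y Z : C)
    (f : mor X Y) (g : mor Y Z) : Prop :=
  forall x : mor Q Y, g ∘ x = 0 <-> exists y : mor Q X, f ∘ y = x.

Record em_resolution (C : preadditive_cat) (P : C -> Prop) (A : C) :=
  EMResolution {
  em_complex :> chain_complex C;
  em_aug : mor (em_complex 0) A;
  em_augK : em_aug ∘ cdiff em_complex 0 = 0;
  em_proj : forall n, P (em_complex n);
  em_exact_aug : forall Q, P Q -> hom_surj Q em_aug;
  em_exact0 : forall Q, P Q -> exact_hom Q (cdiff em_complex 0) em_aug;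
  em_exact : forall Q n, P Q ->
    exact_hom Q (cdiff em_complex n.+1) (cdiff em_complex n) }.

(* Kernel pairs and cubical kernels are unique up to isomorphism, so it does not
   matter which one is used in [cub_e1] and [cub_e]. *)
Record cubical_resolution (C : preadditive_cat) (P : C -> Prop) (A : C) :=
  CubicalResolution {
  cub_obj :> precubical C;
  cub_aug : mor (cub_obj 0) A;
  cub_augP : cub_aug ∘ face cub_obj 0 ord0 false
             = cub_aug ∘ face cub_obj 0 ord0 true;
  cub_proj : forall n, P (cub_obj n);
  cub_aug_epi : P_epi P cub_aug;
  cub_e1 : exists (K : C) (k : bool -> mor K (cub_obj 0))
                  (e : mor (cub_obj 1) K),
    [/\ is_kernel_pair cub_aug k,
        forall a, k a ∘ e = face cub_obj 0 ord0 a
      & P_epi P e];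
  cub_e : forall n, exists (K : C) (k : 'I_n.+2 -> bool -> mor K (cub_obj n.+1))
                  (e : mor (cub_obj n.+2) K),
    [/\ is_cubical_kernel (face cub_obj n) k,
        forall i a, k i a ∘ e = face cub_obj n.+1 i a
      & P_epi P e] }.

Section Derived.
Context {A B : abelian_cat} (P : A -> Prop).

Section EilenbergMoore.
Variable (S : forall X : A, em_resolution P X).

Definition em_lifts (X Y : A) (f : mor X Y) (phi : chain_map (S X) (S Y)) :=
  em_aug (S Y) ∘ phi 0 = f ∘ em_aug (S X).

Definition em_derived (T : add_functor A B) (n : nat) (X : A) : B :=
  homology (fcomplex T (S X)) n.

(* The morphism induced by a lift of [f]: by the comparison theorem a lift
   exists (so the dummy 0 is never taken), and the result does not depend on
   it. The same remark applies to [cub_derived_map]. *)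
Definition em_derived_map (T : add_functor A B) (n : nat) (X Y : A)
    (f : mor X Y) : mor (em_derived T n X) (em_derived T n Y) :=
  xget 0 (fun g => exists2 phi, em_lifts f phi
                              & g = homology_map (fchain_map T phi) n).

Definition em_derived_nt (T T' : add_functor A B) (eta : nat_trans T T')
    (n : nat) (X : A) : mor (em_derived T n X) (em_derived T' n X) :=
  homology_map (nt_chain_map eta (S X)) n.

End EilenbergMoore.

Section Cubical.
Variable (R : forall X : A, cubical_resolution P X).

Definition cub_lifts (X Y : A) (f : mor X Y) (phi : precubical_map (R X) (R Y)) :=
  cub_aug (R Y) ∘ phi 0 = f ∘ cub_aug (R X).

Definition cub_derived (T : add_functor A B) (n : nat) (X : A) : B :=
  homology (normalized (fprecubical T (R X))) n.

Definition cub_derived_map (T : add_functor A B) (n : nat) (X Y : A)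
    (f : mor X Y) : mor (cub_derived T n X) (cub_derived T n Y) :=
  xget 0 (fun g => exists2 phi, cub_lifts f phi
    & g = homology_map (norm_map (fprecubical_map T phi)) n).

Definition cub_derived_nt (T T' : add_functor A B) (eta : nat_trans T T')
    (n : nat) (X : A) : mor (cub_derived T n X) (cub_derived T' n X) :=
  homology_map (norm_map (nt_precubical_map eta (R X))) n.

End Cubical.

End Derived.

(* Main.v *)
(* For a cubical resolution X of A, the normalized complex N(X) is itself a
   resolution of A in the sense of Eilenberg and Moore. Since every X_n is in P,
   pseudo-degeneracies s_k can be lifted through the maps to the cubical kernels;
   the product of the 1 - s_k ∂_k^1 projects X_n onto N_n(X), so that N_n(X) is in
   P by closure under retracts, and N commutes with additive functors:
   N(T X) = T(N X). The comparison theorem for Eilenberg-Moore resolutions then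
   gives the isomorphism and its naturality.

   Exactness of Hom(Q, N(X)): here only the faces ∂_i^0 survive, and every
   compatible family of elements is the family of faces of some element. A cycle
   x is homologous to x - d(h x), where h x is a cone on x, and this difference
   has vanishing first face; dropping the first face, one concludes by induction
   on the degree. *)
From mathcomp Require Import all_boot all_algebra.
From mathcomp Require Import boolp classical_sets.
Require Import Defs.

Set Implicit Arguments.
Unset Strict Implicit.
Unset Printing Implicit Defensive.
Import GRing.Theory.
Local Open Scope ring_scope.
Local Open Scope cat_scope.

(** * Additive preliminaries, chain maps and chain homotopies *)

Lemma compBl (C : preadditive_cat) (X Y Z : C) (g g' : mor Y Z) (f : mor X Y) :
  (g - g') ∘ f = g ∘ f - g' ∘ f.
Proof. by rewrite compDl compNl. Qed.

Lemma compBr (C : preadditive_cat) (X Y Z : C) (g : mor Y Z) (f f' : mor X Y) :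
  g ∘ (f - f') = g ∘ f - g ∘ f'.
Proof. by rewrite compDr compNr. Qed.

Lemma cokern_epi (C : abelian_cat) (X Y : C) (f : mor X Y) : epi (cokern f).
Proof.
have [q0 uq] := cokerP f; move=> D u v uv.
have [|w [_ wP]] := uq D (u ∘ cokern f); first by rewrite -compA q0 comp0r.
by rewrite -(wP u erefl) -(wP v (esym uv)).
Qed.

Section ChainMaps.
Context {C : preadditive_cat}.
Implicit Types X Y Z : chain_complex C.

Definition chain_id X : chain_map X X.
Proof. by exists (fun n => idm (X n)) => n; rewrite comp_idl comp_idr. Defined.

Definition chain_comp X Y Z (g : chain_map Y Z) (f : chain_map X Y) :
  chain_map X Z.
Proof.
by exists (fun n => g n ∘ f n) => n; rewrite compA cmapP -!compA cmapP.
Defined.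

Definition homotopic X Y (f g : chain_map X Y) : Prop :=
  exists h : forall n, mor (X n) (Y n.+1),
    f 0 - g 0 = cdiff Y 0 ∘ h 0 /\
    forall n, f n.+1 - g n.+1 = cdiff Y n.+1 ∘ h n.+1 + h n ∘ cdiff X n.

End ChainMaps.

Lemma fmapN (C D : preadditive_cat) (T : add_functor C D) (X Y : C)
  (f : mor X Y) : fmap T (- f) = - fmap T f.
Proof. by apply: (addrI (fmap T f)); rewrite -fmapD !subrr fmap0. Qed.

Lemma fmap_sum (C D : preadditive_cat) (T : add_functor C D) (X Y : C)
    I (r : seq I) p (F : I -> mor X Y) :
  fmap T (\sum_(i <- r | p i) F i) = \sum_(i <- r | p i) fmap T (F i).
Proof. by apply: (big_morph (fmap T)) => [f f'|]; rewrite ?fmapD ?fmap0. Qed.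

Lemma fmap_mulz (C D : preadditive_cat) (T : add_functor C D) (X Y : C)
  (f : mor X Y) (z : int) : fmap T (f *~ z) = fmap T f *~ z.
Proof.
have natr n : fmap T (f *+ n) = fmap T f *+ n.
  by elim: n => [|n IH]; rewrite ?mulr0n ?fmap0 // !mulrS fmapD IH.
by case: z => n; rewrite ?NegzE ?mulrNz -!pmulrn ?fmapN natr.
Qed.

Lemma homotopic_fmap (C D : preadditive_cat) (T : add_functor C D)
    (X Y : chain_complex C) (f g : chain_map X Y) :
  homotopic f g -> homotopic (fchain_map T f) (fchain_map T g).
Proof.
move=> [h [h0 hS]]; exists (fun n => fmap T (h n)).
by split=> [|n]; rewrite /= -fmapN -?fmap_comp -!fmapD ?h0 ?hS.
Qed.

(** * Homology as a homotopy-invariant functor *)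

Section HomologyFunctor.
Context {C : abelian_cat}.
Implicit Types X Y Z : chain_complex C.

(** Only the component in degree [n] enters the construction, so chain maps can be exchanged without
    comparing the whole records. *)
Lemma eq_homology_map X Y (f g : chain_map X Y) n :
  f n = g n -> homology_map f n = homology_map g n.
Proof. by rewrite /homology_map /cycles_map => ->. Qed.

Lemma homology_map_id X n :
  homology_map (chain_id X) n = idm (homology X n).
Proof.
apply: cokern_epi; rewrite homology_mapP comp_idl.
rewrite (_ : cycles_map _ _ = idm _) ?comp_idr //.
by apply: (@sinc_mono _ _ (cycles X n)); rewrite cycles_mapP comp_idl comp_idr.
Qed.

Lemma homology_map_comp X Y Z (g : chain_map Y Z) (f : chain_map X Y) n :
  homology_map (chain_comp g f) n = homology_map g n ∘ homology_map f n.
Proof.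
apply: cokern_epi; rewrite homology_mapP -compA homology_mapP compA.
rewrite homology_mapP -compA; congr (_ ∘ _).
apply: (@sinc_mono _ _ (cycles Z n)).
by rewrite cycles_mapP compA cycles_mapP -!compA cycles_mapP.
Qed.

Lemma homotopic_homology X Y (f g : chain_map X Y) n :
  homotopic f g -> homology_map f n = homology_map g n.
Proof.
move=> [h [h0 hS]]; apply: cokern_epi; rewrite !homology_mapP.
(* On cycles the term [h ∘ d] vanishes, while [d ∘ h] factors through [bound], which the cokernel
   kills. *)
suff E : cycles_map f n = cycles_map g n + bound Y n ∘ (h n ∘ sinc (cycles X n)).
  by rewrite E compDr [X in _ + X]compA (proj1 (cokerP _)) comp0l addr0.
apply: (@sinc_mono _ _ (cycles Y n)).
rewrite compDr !cycles_mapP !compA boundP -compDl.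
case: n => [|n]; first by rewrite -h0 addrC subrK.
have Z : cdiff X n ∘ sinc (cycles X n.+1) = 0 by exact: comp_ker.
rewrite -[f n.+1](subrK (g n.+1)) hS addrAC compDl.
by rewrite !compDl -(compA (h n)) Z comp0r addr0 addrC.
Qed.

End HomologyFunctor.

(** * The comparison theorem for Eilenberg-Moore resolutions *)

Section Comparison.
Context {C : preadditive_cat} (P : C -> Prop).
Variables (X Y : C) (E : em_resolution P X) (F : em_resolution P Y).

(** Each component is a chosen solution of the lifting equation; [em_lift_exists] shows that a
    solution exists in every degree, so the default 0 is not taken for want of one. *)
Fixpoint em_lift_seq (f : mor X Y) n : mor (E n) (F n) :=
  if n is m.+1 return mor (E n) (F n)
  then xget 0 (fun u => cdiff F m ∘ u = em_lift_seq f m ∘ cdiff E m)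
  else xget 0 (fun u => em_aug F ∘ u = f ∘ em_aug E).

Lemma em_lift_exists (f : mor X Y) :
  exists phi : chain_map E F, em_aug F ∘ phi 0 = f ∘ em_aug E.
Proof.
have u0 : em_aug F ∘ em_lift_seq f 0 = f ∘ em_aug E.
  apply: (@xgetPex _ 0 (fun u => em_aug F ∘ u = f ∘ em_aug E)).
  exact: em_exact_aug (em_proj E 0) _.
have uS n : cdiff F n ∘ em_lift_seq f n.+1 = em_lift_seq f n ∘ cdiff E n.
  elim: n => [|n IH];
    apply: (@xgetPex _ 0 (fun u => cdiff F _ ∘ u = em_lift_seq f _ ∘ cdiff E _)).
    apply/(em_exact0 (e := F) (em_proj E 1)).
    by rewrite compA u0 -compA em_augK comp0r.
  apply/(em_exact (e := F) (em_proj E n.+2)).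
  by rewrite compA IH -compA cdiffK comp0r.
by exists (ChainMap uS).
Qed.

Fixpoint em_homotopy_seq (f g : chain_map E F) n : mor (E n) (F n.+1) :=
  if n is m.+1 return mor (E n) (F n.+1)
  then xget 0 (fun u => cdiff F m.+1 ∘ u
                        = f m.+1 - g m.+1 - em_homotopy_seq f g m ∘ cdiff E m)
  else xget 0 (fun u => cdiff F 0 ∘ u = f 0 - g 0).

Lemma em_lift_unique (f g : chain_map E F) :
  em_aug F ∘ f 0 = em_aug F ∘ g 0 -> homotopic f g.
Proof.
move=> fg; exists (em_homotopy_seq f g).
have h0 : cdiff F 0 ∘ em_homotopy_seq f g 0 = f 0 - g 0.
  apply: (@xgetPex _ 0 (fun u => cdiff F 0 ∘ u = f 0 - g 0)).
  by apply/(em_exact0 (e := F) (em_proj E 0)); rewrite compBr fg subrr.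
(* Moving [h_n ∘ d] to the other side gives the equation defining [h_(n+1)]. Its right-hand side is
   killed by [d] because of the relation one degree lower, so exactness provides a solution. *)
split=> // n; apply/eqP; rewrite -subr_eq; apply/eqP/esym; elim: n => [|n IH];
  apply: (@xgetPex _ 0 (fun u => cdiff F _ ∘ u
                        = f _ - g _ - em_homotopy_seq f g _ ∘ cdiff E _));
  apply/(em_exact (e := F) (em_proj E _)); rewrite !compBr !cmapP compA.
  by rewrite h0 compBl subrr.
by rewrite IH !compBl -[X in _ - (_ - X)]compA cdiffK comp0r subr0 subrr.
Qed.

End Comparison.

(** * Presimplicial groups: alternating sums, fillers and acyclicity *)

Section AlternatingSum.

Definition alt_sum (M : nat -> zmodType) (d : forall n, nat -> M n.+1 -> M n) n
  (x : M n.+1) : M n := \sum_(i < n.+1) d n i x *~ (-1) ^+ i.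

Record semi_faces (M : nat -> zmodType) (d : forall n, nat -> M n.+1 -> M n) :
    Prop := SemiFaces {
  sf_add : forall n i, {morph d n i : x y / x + y};
  sf_comm : forall n i j (x : M n.+2), (i < j < n.+2)%N ->
    d n i (d n.+1 j x) = d n j.-1 (d n.+1 i x) }.

(** The décalage: the first face is forgotten and degrees drop by one, so the groups become
    [M \o S]. *)
Definition shift_faces (M : nat -> zmodType)
    (d : forall n, nat -> M n.+1 -> M n) n i : M n.+2 -> M n.+1 :=
  d n.+1 i.+1.

Section Additivity.
Variables (M : nat -> zmodType) (d : forall n, nat -> M n.+1 -> M n).
Arguments d : clear implicits.
Hypothesis dP : semi_faces d.

Lemma face0 n i : d n i 0 = 0.
Proof. by apply: (addrI (d n i 0)); rewrite -(sf_add dP) !addr0. Qed.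

Lemma faceN n i x : d n i (- x) = - d n i x.
Proof. by apply: (addrI (d n i x)); rewrite -(sf_add dP) !subrr face0. Qed.

Lemma face_sum n i I (r : seq I) p (F : I -> M n.+1) :
  d n i (\sum_(k <- r | p k) F k) = \sum_(k <- r | p k) d n i (F k).
Proof. by apply: (big_morph (d n i)); [apply: sf_add | apply: face0]. Qed.

Lemma face_mulz n i x (z : int) : d n i (x *~ z) = d n i x *~ z.
Proof.
have natr m : d n i (x *+ m) = d n i x *+ m.
  by elim: m => [|m IH]; rewrite ?mulr0n ?face0 // !mulrS (sf_add dP) IH.
by case: z => m; rewrite ?NegzE ?mulrNz -!pmulrn ?faceN natr.
Qed.

Lemma alt_sumB n x y :
  alt_sum d (n := n) (x - y) = alt_sum d x - alt_sum d y.
Proof.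
rewrite /alt_sum -sumrB; apply: eq_bigr => i _.
by rewrite (sf_add dP) faceN mulrzBl.
Qed.

(** Shifting changes the parity of each index, whence the minus sign. [alt_sumK] and
    [filling_acyclic] are inductions along this formula. *)
Lemma alt_sum_shift n (x : M n.+2) :
  alt_sum d x = d n.+1 0%N x - alt_sum (M := M \o S) (shift_faces d) x.
Proof.
rewrite /alt_sum big_ord_recl expr0 -sumrN; congr (_ + _).
by apply: eq_bigr => i _; rewrite exprS mulN1r mulrNz.
Qed.

Lemma shift_semi_faces : semi_faces (M := M \o S) (shift_faces d).
Proof.
split=> [n i x y|n i j x /andP[ij jn]]; first exact: (sf_add dP).
have j0 : (0 < j)%N by apply: leq_ltn_trans ij.
by rewrite /shift_faces (sf_comm dP) /= ?prednK ?ltnS ?ij.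
Qed.

End Additivity.

Lemma alt_sumK n (M : nat -> zmodType) (d : forall n, nat -> M n.+1 -> M n) :
  semi_faces d -> forall x : M n.+2, alt_sum d (alt_sum d x) = 0.
Proof.
elim: n M d => [|n IH] M d dP x.
  rewrite /alt_sum big_ord1 big_ord_recl big_ord1 /= !expr0 expr1 mulrNz.
  rewrite (sf_add dP) (faceN dP) [X in _ - X](sf_comm dP) //=.
  exact: subrr.
rewrite alt_sum_shift (alt_sum_shift d x).
rewrite (alt_sumB (shift_semi_faces dP)) (IH (M \o S)); last first.
  exact: shift_semi_faces.
rewrite subr0 (sf_add dP) (faceN dP) -addrA -opprD; apply/eqP.
rewrite subr_eq0 -subr_eq -alt_sum_shift; apply/eqP.
(* What remains is that the alternating sum of [d_0 x] equals [d_0] of the shifted alternating sum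
   of [x]: termwise, [d_i d_0 = d_0 d_(i+1)]. *)
rewrite /alt_sum [RHS](face_sum dP); apply: eq_bigr => i _.
rewrite (face_mulz dP) /shift_faces [X in _ = X *~ _](sf_comm dP) //.
exact: ltn_ord i.
Qed.

(* An augmented presimplicial group (the subgroups [U n] of the [M n]) in which
   every boundary of a simplex has a filler. An element of degree [n] has faces
   [0, ..., n - 1], so the simplicial dimension is [n - 1]; faces of index at
   least [n] are meaningless. *)
Record filling (M : nat -> zmodType) (d : forall n, nat -> M n.+1 -> M n)
    (U : forall n, M n -> Prop) : Prop := Filling {
  fl_faces :> semi_faces d;
  fl_U0 : forall n, U n 0;
  fl_UB : forall n x y, U n x -> U n y -> U n (x - y);
  fl_Ud : forall n i x, (i < n.+1)%N -> U n.+1 x -> U n (d n i x);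
  fl_fill0 : forall y, U 0%N y -> exists2 z, U 1%N z & d 0%N 0%N z = y;
  fl_fillS : forall n (y : nat -> M n.+1),
    (forall i, (i < n.+2)%N -> U n.+1 (y i)) ->
    (forall i j, (i < j < n.+2)%N -> d n i (y j) = d n j.-1 (y i)) ->
    exists2 z, U n.+2 z & forall i, (i < n.+2)%N -> d n.+1 i z = y i }.

(** To fill in the shifted object, prepend 0 as first face. The longer family is compatible because
    the given elements lie in the kernel of [d_0], and its filler lies there too. *)
Lemma shift_filling (M : nat -> zmodType) (d : forall n, nat -> M n.+1 -> M n) U :
  filling d U ->
  filling (M := M \o S) (shift_faces d) (fun n x => U n.+1 x /\ d n 0%N x = 0).
Proof.
move=> F; split.
- exact: (shift_semi_faces F).
- by move=> n; split; [apply: fl_U0 F _ | rewrite (face0 F)].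
- move=> n x y [Ux x0] [Uy y0]; split; first exact: (fl_UB F).
  by rewrite (sf_add F) (faceN F) x0 y0 subr0.
- move=> n i x le_in [Ux x0]; split; first exact: (fl_Ud F).
  by rewrite /shift_faces (sf_comm F) ?ltnS //= x0 (face0 F).
- move=> y [Uy y0].
  have [||z Uz zP] := @fl_fillS _ _ _ F 0 (fun i => if i is 0 then 0 else y).
  + by case=> [|i] _ //; apply: fl_U0 F _.
  + case=> [|i] [|[|j]] //=; last by rewrite andbF.
    by rewrite y0 (face0 F).
  by exists z; [split=> //; apply: zP | apply: zP].
- move=> n y Uy yC.
  have [||z Uz zP] :=
    @fl_fillS _ _ _ F n.+1 (fun i => if i is j.+1 then y j else 0).
  + case=> [|i] le_in; first exact: fl_U0 F _.
    by case: (Uy i le_in).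
  + case=> [|i] [|j] // /andP[ij jn]; rewrite ?(face0 F) /=.
      by case: (Uy j).
    have {yC} : d n.+1 i.+1 (y j) = d n.+1 j.-1.+1 (y i).
      by apply: yC; apply/andP.
    rewrite /shift_faces => ->.
    by case: j ij jn.
  exists z; first by split=> //; apply: zP.
  by move=> i le_in; apply: (zP i.+1).
Qed.

(* An extra degeneracy, [∂_0 h x = x] and [∂_(i+1) h x = h ∂_i x]; it is chosen
   element by element and is not additive. *)
Fixpoint cone (M : nat -> zmodType) (d : forall n, nat -> M n.+1 -> M n)
    (U : forall n, M n -> Prop) n : M n -> M n.+1 :=
  if n is m.+1 return M n -> M n.+1
  then fun x => xget 0 (fun z => U m.+2 z /\ d m.+1 0%N z = x /\
         forall i, (i < m.+1)%N -> d m.+1 i.+1 z = cone d U (d m i x))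
  else fun x => xget 0 (fun z => U 1%N z /\ d 0%N 0%N z = x).

(** The prescribed faces [x], [h ∂_0 x], [h ∂_1 x], ... are compatible by the same identities one
    degree lower, so a filler exists for [xget] to pick. In degree 0 only [∂_0 h x = x] is left;
    this is [cone0]. *)
Lemma coneP (M : nat -> zmodType) (d : forall n, nat -> M n.+1 -> M n) U :
  filling d U -> forall n x, U n.+1 x ->
  [/\ U n.+2 (cone d U x), d n.+1 0%N (cone d U x) = x
    & forall i, (i < n.+1)%N -> d n.+1 i.+1 (cone d U x) = cone d U (d n i x)].
Proof.
move=> F; have cone0 x : U 0%N x -> U 1%N (cone d U x) /\ d 0%N 0%N (cone d U x) = x.
  move=> Ux; apply: (@xgetPex _ 0 (fun z => U 1%N z /\ d 0%N 0%N z = x)).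
  by have [z] := fl_fill0 F Ux; exists z.
elim=> [|n IH] x Ux.
  suff: U 2%N (cone d U x) /\ d 1%N 0%N (cone d U x) = x /\
      forall i, (i < 1)%N -> d 1%N i.+1 (cone d U x) = cone d U (d 0%N i x).
    by move=> [? []].
  apply: (@xgetPex _ 0 (fun z => U 2%N z /\ d 1%N 0%N z = x /\
      forall i, (i < 1)%N -> d 1%N i.+1 z = cone d U (d 0%N i x))).
  have [||z Uz zP] :=
    @fl_fillS _ _ _ F 0 (fun i => if i is j.+1 then cone d U (d 0%N j x) else x).
  - case=> [|[|i]] // _.
    by case: (cone0 (d 0%N 0%N x)) => //; apply: (fl_Ud F).
  - case=> [|i] [|[|j]] //=; last by rewrite andbF.
    by case: (cone0 (d 0%N 0%N x)) => //; apply: (fl_Ud F).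
  exists z; split=> //; split; first exact: zP.
  by case=> // _; apply: (zP 1).
suff: U n.+3 (cone d U x) /\ d n.+2 0%N (cone d U x) = x /\
    forall i, (i < n.+2)%N -> d n.+2 i.+1 (cone d U x) = cone d U (d n.+1 i x).
  by move=> [? []].
apply: (@xgetPex _ 0 (fun z => U n.+3 z /\ d n.+2 0%N z = x /\
    forall i, (i < n.+2)%N -> d n.+2 i.+1 z = cone d U (d n.+1 i x))).
have Ud i : (i < n.+2)%N -> U n.+1 (d n.+1 i x) by move=> ?; apply: (fl_Ud F).
have [||z Uz zP] :=
  @fl_fillS _ _ _ F n.+1
    (fun i => if i is j.+1 then cone d U (d n.+1 j x) else x).
- by case=> [|i] // le_in; case: (IH _ (Ud i le_in)).
- case=> [|i] [|j] // /andP[ij jn]; rewrite [_.-1]/=;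
    have [_ c0 cS] := IH _ (Ud j jn).
    by rewrite c0.
  have iN : (i < n.+1)%N.
    exact: leq_trans (ij : (i < j)%N) (jn : (j <= n.+1)%N).
  rewrite cS // (sf_comm F); last by apply/andP.
  have [_ _ cS'] := IH _ (Ud i (ltnW iN)).
  by case: j ij jn {c0 cS} => // j ij jn; rewrite cS'.
by exists z; split=> //; split; [apply: zP | move=> i le_in; apply: (zP i.+1)].
Qed.

(** Degree 0 imposes nothing: in the application, membership in [U 0] already says that the
    augmentation vanishes. *)
Definition alt_cycle (M : nat -> zmodType) (d : forall n, nat -> M n.+1 -> M n)
    n : M n -> Prop :=
  if n is m.+1 return M n -> Prop then fun x => alt_sum d x = 0 else fun=> True.

Lemma filling_acyclic n (M : nat -> zmodType)
    (d : forall n, nat -> M n.+1 -> M n) U :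
  filling d U -> forall x, U n x -> alt_cycle d x ->
  exists2 y, U n.+1 y & alt_sum d y = x.
Proof.
elim: n M d U => [|n IH] M d U F x Ux x0.
  have [z Uz <-] := fl_fill0 F Ux; exists z => //.
  by rewrite /alt_sum big_ord1.
have [Uc c0 cS] := coneP F Ux.
pose w := x - alt_sum d (cone d U x).
(* The first face of the cone cancels [x]. Since the cone is not additive, a sum of cones is left
   rather than the cone of a sum. *)
have wE : w = \sum_(i < n.+1) cone d U (d n i x) *~ (-1) ^+ i.
  rewrite /w alt_sum_shift // c0 opprB addrC subrK.
  by apply: eq_bigr => i _; rewrite /shift_faces cS.
have Ualt m y : U m.+1 y -> U m (alt_sum d y).
  have UN z : U m z -> U m (- z).
    by rewrite -sub0r; apply: (fl_UB F); apply: (fl_U0 F).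
  have UD z z' : U m z -> U m z' -> U m (z + z').
    by move=> Uz Uz'; rewrite -[z']opprK; apply: (fl_UB F) => //; apply: UN.
  move=> Uy; apply: big_ind => //; first exact: (fl_U0 F).
  move=> i _; have Ui : U m (d m i y) by apply: (fl_Ud F).
  by rewrite -signr_odd; case: odd; rewrite ?expr1 ?mulrNz //; apply: UN.
have Uw : U n.+1 w by apply: (fl_UB F) => //; apply: Ualt.
(* [d_0] is additive and undoes each cone, so it sends [w] to the alternating sum of [x], which is
   0. *)
have w0 : d n 0%N w = 0.
  have dc z : U n z -> d n 0%N (cone d U z) = z.
    case: n {IH x x0 Ux Uc c0 cS w wE Uw} z => [|n] z Uz.
      suff: U 1%N (cone d U z) /\ d 0%N 0%N (cone d U z) = z by case.
      apply: (@xgetPex _ 0 (fun y => U 1%N y /\ d 0%N 0%N y = z)).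
      by have [y] := fl_fill0 F Uz; exists y.
    by case: (coneP F Uz).
  rewrite wE (face_sum F) -[RHS]x0; apply: eq_bigr => i _.
  by rewrite (face_mulz F) dc //; apply: (fl_Ud F).
have [||y [Uy y0] yw] := IH (M \o S) (shift_faces d) _ (shift_filling F) w.
- by [].
- clear wE; case: n {IH Uc c0 cS} x x0 Ux @w Uw w0 => [//|n] x x0 Ux w Uw w0.
  (* As [d_0 w = 0], the shifted sum of [w] is, up to sign, the full one, and [w] differs from the
     cycle [x] by a boundary. *)
  change (alt_sum (M := M \o S) (shift_faces d) w = 0).
  apply: oppr_inj; rewrite oppr0 -sub0r -[X in X - _]w0 -alt_sum_shift.
  by rewrite /w (alt_sumB F) x0 (alt_sumK F) subrr.
(* Since [d_0 y = 0], the full alternating sum of [y] is [- w]; hence the minus sign before [y]. *)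
exists (cone d U x - y); first exact: (fl_UB F).
rewrite (alt_sumB F) [X in _ - X]alt_sum_shift y0 yw sub0r opprK.
by rewrite addrC subrK.
Qed.

End AlternatingSum.

(** * Cubical resolutions: fillers, lifts and pseudo-degeneracies *)

Section CubicalResolution.
Context {C : preadditive_cat} (P : C -> Prop).

Section Filling.
Variables (A : C) (X : cubical_resolution P A) (Q : C).
Hypothesis PQ : P Q.

(** A compatible family is a morphism to the kernel pair, and such a morphism lifts along the
    P-epimorphic [e]. [cub_fillS] does the same with cubical kernels. *)
Lemma cub_fill0 (h : bool -> mor Q (X 0)) :
  cub_aug X ∘ h false = cub_aug X ∘ h true ->
  exists u : mor Q (X 1), forall i e, face X 0 i e ∘ u = h e.
Proof.
have [K [k [e [[_ uk] ke Pe]]]] := cub_e1 X.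
move=> /uk[v [vP _]]; have [u uP] := Pe Q PQ v.
by exists u => i a; rewrite (ord1 i) -ke -compA uP vP.
Qed.

Lemma cub_fillS n (h : 'I_n.+2 -> bool -> mor Q (X n.+1)) :
  cubical_identities (face X n) h ->
  exists u : mor Q (X n.+2), forall i e, face X n.+1 i e ∘ u = h i e.
Proof.
have [K [k [e [[_ uk] ke Pe]]]] := cub_e X n.
move=> /uk[v [vP _]]; have [u uP] := Pe Q PQ v.
by exists u => i a; rewrite -ke -compA uP vP.
Qed.

(** These are the elements of Hom(Q, N_n X) for n > 0. In degree 0 the kernel of the augmentation
    takes the place of N_0, so that acyclicity covers exactness at [X 0]. *)
Definition cub_normal n : mor Q (X n) -> Prop :=
  if n is m.+1 return mor Q (X n) -> Prop
  then fun x => forall i, face X m i true ∘ x = 0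
  else fun x => cub_aug X ∘ x = 0.

(** A filler is obtained by prescribing 0 for all faces [∂_i^1]; the mixed cubical identities then
    hold because the prescribed [∂_i^0] are normal. *)
Lemma cub_filling :
  filling (M := fun n => mor Q (X n))
    (fun n i x => face X n (inord i) false ∘ x) cub_normal.
Proof.
split.
- split=> [n i x y|n i j x ij]; first exact: compDr.
  by rewrite !compA faceP.
- by case=> [|n]; [exact: comp0r | move=> i; exact: comp0r].
- case=> [|n] x y /= Ux Uy; first by rewrite compBr Ux Uy subrr.
  by move=> i; rewrite compBr Ux Uy subrr.
- case=> [|n] i x lin Ux /=.
    case: i lin => // _; rewrite compA (_ : inord 0 = ord0); last first.
      by apply: val_inj; rewrite /= inordK.
    by rewrite cub_augP -compA Ux comp0r.
  move=> j; rewrite compA; have [ji|ij] := ltnP j i.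
    rewrite -(inord_val j) faceP ?ji // -compA.
    by rewrite Ux comp0r.
  have jn : (j.+1 < n.+2)%N by exact: (ltn_ord j).
  have := @faceP _ X n i j.+1 false true; rewrite ltnS ij jn => /(_ isT) /=.
  by rewrite inord_val => <-; rewrite -compA Ux comp0r.
- move=> y Uy.
  have [|u uP] := cub_fill0 (h := fun e => if e then 0 else y).
    by rewrite Uy comp0r.
  by exists u => [i|]; rewrite uP.
- move=> n y Uy yC.
  have [|u uP] := cub_fillS (n := n) (h := fun i e => if e then 0 else y i).
    move=> i j a e /andP[ij jn].
    have iN : (i < n.+2)%N by apply: ltn_trans jn.
    rewrite !inordK //; case: a; case: e; rewrite ?comp0r //; last first.
    - by apply: yC; rewrite ij.
    - by rewrite (Uy i iN).
    - by rewrite (Uy j jn).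
  exists u => [i|i iN]; first by rewrite uP.
  by rewrite uP inordK.
Qed.

End Filling.

Section Lift.
Variables (A B : C) (X : cubical_resolution P A) (Y : cubical_resolution P B).

Fixpoint cub_lift_seq (f : mor A B) n : mor (X n) (Y n) :=
  if n is m.+1 return mor (X n) (Y n)
  then xget 0 (fun u => forall i e,
         face Y m i e ∘ u = cub_lift_seq f m ∘ face X m i e)
  else xget 0 (fun u => cub_aug Y ∘ u = f ∘ cub_aug X).

(** It ensures that [cub_derived_map] finds a lift to choose. The component already built, composed
    with the faces of [X], is a compatible family in [Y], hence has a filler. *)
Lemma cub_lift_exists (f : mor A B) :
  exists phi : precubical_map X Y, cub_aug Y ∘ phi 0 = f ∘ cub_aug X.
Proof.
have u0 : cub_aug Y ∘ cub_lift_seq f 0 = f ∘ cub_aug X.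
  apply: (@xgetPex _ 0 (fun u => cub_aug Y ∘ u = f ∘ cub_aug X)).
  exact: cub_aug_epi (cub_proj X 0) _.
have uS n : forall i e,
    face Y n i e ∘ cub_lift_seq f n.+1 = cub_lift_seq f n ∘ face X n i e.
  elim: n => [|n IH]; apply: (@xgetPex _ 0 (fun u => forall i e,
         face Y _ i e ∘ u = cub_lift_seq f _ ∘ face X _ i e)).
    have [|u uP] := cub_fill0 (X := Y) (cub_proj X 1)
      (h := fun e => cub_lift_seq f 0 ∘ face X 0 ord0 e).
      by rewrite !compA u0 -!compA cub_augP.
    by exists u => i e; rewrite uP (ord1 i).
  apply: (cub_fillS (cub_proj X n.+2)
    (h := fun i e => cub_lift_seq f n.+1 ∘ face X n.+1 i e)).
  by move=> i j a e ij; rewrite !compA !IH -!compA faceP.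
by exists (PrecubicalMap uS).
Qed.

End Lift.

Section Degeneracies.
Variables (A : C) (X : cubical_resolution P A).

Let F n i e := face X n (inord i) e.

(* The face [i] of the degeneracy [k], in terms of degeneracies [s] one degree
   below. *)
Definition degen_face n (s : nat -> mor (X n) (X n.+1)) (k i : nat) e :
    mor (X n.+1) (X n.+1) :=
  if (i < k)%N then s k.-1 ∘ face X n (inord i) e
  else if i == k then idm _ else s k ∘ face X n (inord i.-1) e.

(** Only identities between faces and degeneracies are imposed, none between two degeneracies. In
    degree 0 the value does not depend on [k]. *)
Fixpoint degen n (k : nat) : mor (X n) (X n.+1) :=
  if n is m.+1 return mor (X n) (X n.+1)
  then xget 0 (fun u => forall (i : 'I_m.+2) e,
         face X m.+1 i e ∘ u = degen_face (degen m) k i e)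
  else xget 0 (fun u => forall i e, face X 0 i e ∘ u = idm (X 0)).
Arguments degen : simpl never.

Lemma degen0 i e k : face X 0 i e ∘ degen 0 k = idm (X 0).
Proof.
apply: (@xgetPex _ 0 (fun u => forall i e, face X 0 i e ∘ u = idm (X 0))).
by have [|u uP] := cub_fill0 (cub_proj X 0) (h := fun e => idm (X 0));
  [|exists u].
Qed.

(** The prescribed faces must form a compatible family. For [i < j] this is checked by the position
    of [k]: an identity face makes it immediate, and the other cases follow from the lemma one
    degree lower and the face identities. *)
Lemma degenS n k : (k < n.+2)%N -> forall i e, (i < n.+2)%N ->
  F n.+1 i e ∘ degen n.+1 k = degen_face (degen n) k i e.
Proof.
move=> kn i e lin; rewrite -[i in RHS](inordK lin) /F.
move: (inord i) e => {lin}; move: i => _.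
elim: n k kn => [|n IH] k kn;
  apply: (@xgetPex _ 0 (fun u => forall i e,
         face X _.+1 i e ∘ u = degen_face (degen _) k i e)).
  apply: (cub_fillS (cub_proj X 1)) => -[|i] [|[|j]] a e //=;
    rewrite ?andbF // => _; rewrite !inordK //.
  by case: k kn => [|[|k]] // _;
    rewrite /degen_face /= compA degen0 comp_idl comp_idr.
have {}IH l i e : (l < n.+2)%N -> (i < n.+2)%N ->
    F n.+1 i e ∘ degen n.+1 l = degen_face (degen n) l i e.
  by move=> ln lin; rewrite /F IH // inordK.
apply: (cub_fillS (cub_proj X n.+2)) => i j a e /andP[ij jn].
have iN : (i < n.+2)%N by exact: leq_trans ij _.
have jN : (j.-1 < n.+2)%N by case: j ij jn.
have j0 : (0 < j)%N by apply: leq_ltn_trans ij.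
have ij1 : (i <= j.-1)%N by rewrite -ltnS prednK.
rewrite !inordK ?(ltnW iN) //; last by apply: leq_trans iN _.
rewrite /degen_face.
have [jk|kj|E] := ltngtP j k.
- have k0 : (0 < k)%N by apply: leq_ltn_trans jk.
  have kN : (k.-1 < n.+2)%N by rewrite -ltnS prednK.
  have ik : (i < k.-1)%N by rewrite -ltnS prednK // (leq_ltn_trans _ jk).
  have jk1 : (j.-1 < k.-1)%N by rewrite -ltnS !prednK.
  rewrite (ltn_trans ij jk) !compA -!/(F _ _ _) !IH // /degen_face ik jk1.
  by rewrite /F -!compA faceP // ij (leq_trans jk).
- have [ik|ki|->] := ltngtP i k.
  + have k0 : (0 < k)%N by apply: leq_ltn_trans ik.
    have kN : (k < n.+2)%N by apply: leq_trans kj _.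
    have kN1 : (k.-1 < n.+2)%N by apply: leq_ltn_trans (leq_pred k) kN.
    have kj1 : (k.-1 < j.-1)%N by rewrite -ltnS !prednK.
    rewrite !compA -!/(F _ _ _) !IH // /degen_face ik.
    rewrite ltnNge (ltnW kj1) /= gtn_eqF // /F -!compA faceP //.
    by rewrite (leq_trans ik) // -ltnS prednK.
  + have kN : (k < n.+2)%N by apply: ltn_trans iN.
    have i0 : (0 < i)%N by apply: leq_ltn_trans ki.
    have kj1 : (k < j.-1)%N by apply: leq_trans ij1.
    rewrite !compA -!/(F _ _ _) !IH // /degen_face.
    rewrite !ltnNge (ltnW kj1) (ltnW ki) /= !gtn_eqF // /F -!compA faceP //.
    by rewrite jN andbT prednK.
  + have kN : (k < n.+2)%N by apply: leq_trans kj _.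
    rewrite compA -!/(F _ _ _) IH // /degen_face ltnn eqxx.
    by rewrite comp_idl comp_idr.
- rewrite -E ij compA -!/(F _ _ _) IH // /degen_face ltnn eqxx.
  by rewrite comp_idl comp_idr.
Qed.

Lemma face_degen_diag n k e : (k < n.+1)%N -> F n k e ∘ degen n k = idm (X n).
Proof.
case: n => [|n] kn; first exact: degen0.
by rewrite degenS // /degen_face ltnn eqxx.
Qed.

Lemma face_degen_lt n i k e : (i < k < n.+2)%N ->
  F n.+1 i e ∘ degen n.+1 k = degen n k.-1 ∘ F n i e.
Proof.
move=> /andP[ik kn].
by rewrite degenS // ?(ltn_trans ik kn) // /degen_face ik.
Qed.

(** Composing with [idm - s_k ∂_k] on the left thus preserves the vanishing of the earlier faces, so
    the projection can be built one index at a time. *)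
Lemma face_degen_compl n i k e : (i < k)%N -> (k < n.+1)%N -> exists w,
  F n i e ∘ (idm _ - degen n k ∘ F n k e) = w ∘ F n i e.
Proof.
case: n => [|n] ik kn; first by case: k kn ik.
have ikn : (i < k < n.+2)%N by rewrite ik.
exists (idm _ - degen n k.-1 ∘ F n k.-1 e).
rewrite compBr comp_idr compA face_degen_lt // compBl comp_idl.
by rewrite -!compA [in LHS]faceP.
Qed.

(* The projection, a product of the [idm - s_k ∂_k^1], is written in the form
   [idm - \sum_j a_j ∘ ∂_j^1] because additive functors preserve this shape, and
   it visibly restricts to the identity on the common kernel of the ∂_j^1. *)
Lemma normal_projection n : exists a : 'I_n.+1 -> mor (X n) (X n.+1),
  forall i, face X n i true ∘ (idm _ - \sum_j a j ∘ face X n j true) = 0.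
Proof.
have H k : (k <= n.+1)%N -> exists a : 'I_n.+1 -> mor (X n) (X n.+1),
    forall i, (i < k)%N ->
      F n i true ∘ (idm _ - \sum_j a j ∘ face X n j true) = 0; last first.
  have [a aP] := H n.+1 (leqnn _).
  by exists a => i; rewrite -(aP i) // /F inord_val.
elim: k => [|k IH] kn; first by exists (fun=> 0).
have {IH}[a aP] := IH (ltnW kn).
set q := idm _ - _ in aP; pose p := idm _ - degen n k ∘ F n k true.
(* These are the coefficients of [p ∘ q]: expanding gives [p] minus the sum of the
   [p ∘ a j ∘ ∂_j^1], and [p] itself contributes [s_k] at [j = k]. *)
exists (fun j => p ∘ a j + (if j == k :> nat then degen n k else 0)).
have -> : idm _ - \sum_(j < n.+1) (p ∘ a j
      + (if j == k :> nat then degen n k else 0)) ∘ face X n j true = p ∘ q.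
  under eq_bigr => j _ do rewrite compDl -compA.
  rewrite big_split /= -comp_sumr.
  have -> : \sum_(j < n.+1) (if j == k :> nat then degen n k else 0)
      ∘ face X n j true = degen n k ∘ F n k true.
    rewrite (bigD1 (inord k)) //= inordK // eqxx big1 ?addr0 // => j jk.
    rewrite ifN ?comp0l //; apply: contra jk => /eqP <-.
    by rewrite inord_val.
  by rewrite /q compBr comp_idr opprD addrA addrAC.
move=> i; rewrite ltnS leq_eqVlt => /orP[/eqP->|ik].
  rewrite compA /p compBr comp_idr compA face_degen_diag // comp_idl subrr.
  exact: comp0l.
have [w wP] := face_degen_compl (i := i) (k := k) (n := n) true ik kn.
by rewrite compA wP -compA aP // comp0r.
Qed.

End Degeneracies.

End CubicalResolution.

(** * The normalized complex as an Eilenberg-Moore resolution *)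

Section NormalizedResolution.
Context {C : abelian_cat} (P : C -> Prop) (A : C).
Variable X : cubical_resolution P A.

(** The idempotent [sinc ∘ r] fixes whatever the [∂_j^1] kill, and so does its image under [T]. The
    second clause makes the inclusion of [N_n(TX)] factor through [T] of that of [N_n(X)]. *)
Lemma nsub_retraction n : exists r : mor (X n) (norm_obj X n),
  r ∘ sinc (nsub X n) = idm _ /\
  forall (D : abelian_cat) (T : add_functor C D),
    fmap T (sinc (nsub X n) ∘ r) ∘ sinc (nsub (fprecubical T X) n)
    = sinc (nsub (fprecubical T X) n).
Proof.
case: n => [|n].
  by exists (idm (X 0)); split=> [|D T]; rewrite ?comp_idl // fmap_id comp_idl.
have [a aP] := normal_projection X n.
have [r rP] := nsub_factor aP.
exists r; split=> [|D T].
  apply: (@sinc_mono _ _ (nsub X n.+1)); rewrite compA rP compBl comp_idl.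
  rewrite comp_suml big1 ?subr0 ?comp_idr // => i _.
  by rewrite -compA face_nsub comp0r.
rewrite rP fmapD fmapN fmap_sum fmap_id compBl comp_idl comp_suml big1 ?subr0 //.
move=> i _; rewrite fmap_comp -compA.
have -> : fmap T (face X n i true) ∘ sinc (nsub (fprecubical T X) n.+1) = 0.
  exact: (@face_nsub _ (fprecubical T X)).
exact: comp0r.
Qed.

Lemma norm_aug_diff :
  cub_aug X ∘ sinc (nsub X 0) ∘ cdiff (normalized X) 0 = 0.
Proof.
rewrite -compA norm_diffP /alt_face big_ord1 expr0 mulr1z compA cub_augP.
by rewrite -compA face_nsub comp0r.
Qed.

Lemma norm_acyclic Q n (x : mor Q (X n)) : P Q -> @cub_normal _ P A X Q n x ->
  alt_cycle (M := fun n => mor Q (X n))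
    (fun n i x => face X n (inord i) false ∘ x) x ->
  exists y : mor Q (norm_obj X n.+1), sinc (nsub X n) ∘ norm_diff X n ∘ y = x.
Proof.
move=> PQ Ux xC.
have [y Uy yx] := filling_acyclic (cub_filling X PQ) Ux xC.
have [u uP] := nsub_factor Uy; exists u.
rewrite norm_diffP -compA uP -yx /alt_sum comp_suml; apply: eq_bigr => i _.
by rewrite comp_mulzl inord_val.
Qed.

Hypothesis retP : retract_closed P.

Definition norm_resolution : em_resolution P A.
Proof.
exists (normalized X) (cub_aug X ∘ sinc (nsub X 0)).
- exact: norm_aug_diff.
(* Closure under retracts enters here. *)
- move=> n; apply: retP (cub_proj X n) _.
  by have [r [rK _]] := nsub_retraction n; exists (sinc (nsub X n)), r.
- move=> Q PQ g; have [h hP] := @cub_aug_epi _ _ _ X Q PQ g.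
  by exists h; rewrite -compA comp_idl.
- move=> Q PQ x; split=> [x0|[y <-]]; last by rewrite compA norm_aug_diff comp0l.
  have [||y yP] := @norm_acyclic Q 0 (sinc (nsub X 0) ∘ x) PQ => //.
    by rewrite /= compA.
  by exists y; apply: (@sinc_mono _ _ (nsub X 0)); rewrite compA.
- move=> Q n PQ x; split=> [x0|[y <-]]; last by rewrite compA cdiffK comp0l.
  have [||y yP] := @norm_acyclic Q n.+1 (sinc (nsub X n.+1) ∘ x) PQ.
  + by move=> i; rewrite compA face_nsub comp0l.
  + have E : alt_face X n ∘ (sinc (nsub X n.+1) ∘ x) = 0.
      by rewrite compA -norm_diffP -compA x0 comp0r.
    apply: etrans E; rewrite comp_suml; apply: eq_bigr => i _.
    by rewrite comp_mulzl inord_val.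
  by exists y; apply: (@sinc_mono _ _ (nsub X n.+1)); rewrite compA.
Defined.

End NormalizedResolution.

(** * Normalization commutes with additive functors *)

Section FunctorNormalized.
Context {C D : abelian_cat} (P : C -> Prop).

Definition norm_fmap_comp (A : C) (X : cubical_resolution P A)
    (T : add_functor C D) n :
    mor (normalized (fprecubical T X) n) (fcomplex T (normalized X) n) :=
  factor (fmap T (sinc (nsub X n))) (sinc (nsub (fprecubical T X) n)).

Section OneResolution.
Variables (A : C) (X : cubical_resolution P A) (T : add_functor C D).
Local Notation TX := (fprecubical T X).

(** An additive functor may destroy monomorphisms, but this one is split. *)
Lemma fmap_nsub_mono n : mono (fmap T (sinc (nsub X n))).
Proof.
have [r [rK _]] := nsub_retraction X n; move=> E u v uv.
by rewrite -[u]comp_idl -[v]comp_idl -fmap_id -rK fmap_comp -!compA uv.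
Qed.

Lemma norm_fmap_compP n :
  fmap T (sinc (nsub X n)) ∘ norm_fmap_comp X T n = sinc (nsub TX n).
Proof.
apply: factorP; have [r [_ rT]] := nsub_retraction X n.
by exists (fmap T r ∘ sinc (nsub TX n)); rewrite compA -fmap_comp rT.
Qed.

Lemma fmap_alt_face n : fmap T (alt_face X n) = alt_face TX n.
Proof. by rewrite fmap_sum; apply: eq_bigr => i _; rewrite fmap_mulz. Qed.

Lemma norm_fmap_compC n :
  cdiff (fcomplex T (normalized X)) n ∘ norm_fmap_comp X T n.+1
  = norm_fmap_comp X T n ∘ cdiff (normalized TX) n.
Proof.
apply: fmap_nsub_mono; rewrite /= !compA norm_fmap_compP norm_diffP.
by rewrite -fmap_comp norm_diffP fmap_comp -compA norm_fmap_compP fmap_alt_face.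
Qed.

Definition norm_fmap : chain_map (normalized TX) (fcomplex T (normalized X)) :=
  ChainMap norm_fmap_compC.

Lemma norm_fmap_iso n : is_iso (norm_fmap n).
Proof.
(* The inverse exists because [T] of the inclusion is still killed by the faces [∂_i^1] of [TX]. *)
have [u uP] : exists u, sinc (nsub TX n) ∘ u = fmap T (sinc (nsub X n)).
  case: n => [|n]; first by exists (fmap T (sinc (nsub X 0))); rewrite comp_idl.
  apply: nsub_factor => i.
  by rewrite -[face _ _ _ _ ∘ _]fmap_comp face_nsub fmap0.
exists u; split.
  apply: (@sinc_mono _ _ (nsub TX n)).
  by rewrite compA uP norm_fmap_compP comp_idr.
by apply: fmap_nsub_mono; rewrite compA norm_fmap_compP uP comp_idr.
Qed.

End OneResolution.

Lemma norm_fmap_natural (A B : C) (X : cubical_resolution P A)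
    (Y : cubical_resolution P B) (T : add_functor C D) (f : precubical_map X Y) n :
  norm_fmap Y T n ∘ norm_map (fprecubical_map T f) n
  = fchain_map T (norm_map f) n ∘ norm_fmap X T n.
Proof.
apply: fmap_nsub_mono; rewrite !compA norm_fmap_compP norm_map_compP.
by rewrite -fmap_comp norm_map_compP fmap_comp -compA norm_fmap_compP.
Qed.

Lemma norm_fmap_nt (A : C) (X : cubical_resolution P A)
    (T T' : add_functor C D) (eta : nat_trans T T') n :
  norm_fmap X T' n ∘ norm_map (nt_precubical_map eta X) n
  = nt_chain_map eta (normalized X) n ∘ norm_fmap X T n.
Proof.
apply: fmap_nsub_mono; rewrite !compA norm_fmap_compP norm_map_compP.
by rewrite -ntP -compA norm_fmap_compP.
Qed.

End FunctorNormalized.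

(** * Isomorphisms in homology and the comparison of the derived functors *)

Lemma is_iso_comp (C : preadditive_cat) (X Y Z : C) (g : mor Y Z) (f : mor X Y) :
  is_iso g -> is_iso f -> is_iso (g ∘ f).
Proof.
move=> [g' [g'g gg']] [f' [f'f ff']]; exists (f' ∘ g'); split.
  by rewrite -compA [g' ∘ _]compA g'g comp_idl f'f.
by rewrite -compA [f ∘ _]compA ff' comp_idl gg'.
Qed.

Lemma homology_map_iso (C : abelian_cat) (X Y : chain_complex C)
    (f : chain_map X Y) n :
  (forall m, is_iso (f m)) -> is_iso (homology_map f n).
Proof.
move=> /(_ _)/cid-/all_sig[g gP].
have gC m : cdiff X m ∘ g m.+1 = g m ∘ cdiff Y m.
  have [gf _] := gP m; have [_ fg] := gP m.+1.
  rewrite -[LHS]comp_idl -gf -compA [f m ∘ _]compA -cmapP.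
  by rewrite -[_ ∘ g _]compA fg comp_idr.
exists (homology_map (ChainMap gC) n).
rewrite -!homology_map_comp -!homology_map_id.
by split; apply: eq_homology_map; case: (gP n).
Qed.

Lemma homology_map_fid (C D : abelian_cat) (T : add_functor C D)
    (X : chain_complex C) n :
  homology_map (fchain_map T (chain_id X)) n = idm _.
Proof.
by rewrite -homology_map_id; apply: eq_homology_map; rewrite /= fmap_id.
Qed.

Lemma homology_map_fcomp (C D : abelian_cat) (T : add_functor C D)
    (X Y Z : chain_complex C) (g : chain_map Y Z) (f : chain_map X Y) n :
  homology_map (fchain_map T (chain_comp g f)) n
  = homology_map (fchain_map T g) n ∘ homology_map (fchain_map T f) n.
Proof.
by rewrite -homology_map_comp; apply: eq_homology_map; rewrite /= fmap_comp.
Qed.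

(** A morphism out of a retract is extended along [r], lifted, and restricted along [s]. *)
Lemma closed_class_retract (C : preadditive_cat) (P : C -> Prop) :
  closed_class P -> retract_closed P.
Proof.
move=> clP X Y PY [s [r rs]]; apply: clP => B B' f Pf g.
have [h hP] := Pf Y PY (g ∘ r).
by exists (h ∘ s); rewrite compA hP -compA rs comp_idr.
Qed.

(** Two lifts of [f] are homotopic, and homotopies survive [T]; so any convenient lift computes the
    chosen map. *)
Lemma em_derived_mapE (A B : abelian_cat) (P : A -> Prop)
    (S : forall X : A, em_resolution P X) (T : add_functor A B) n
    (X Y : A) (f : mor X Y) (phi : chain_map (S X) (S Y)) :
  em_lifts f phi ->
  em_derived_map S T n f = homology_map (fchain_map T phi) n.
Proof.
move=> phiP; rewrite /em_derived_map; case: xgetP => [_ -> [psi psiP ->]|].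
  apply/homotopic_homology/homotopic_fmap/em_lift_unique.
  by rewrite psiP phiP.
by move=> /(_ (homology_map (fchain_map T phi) n)) []; exists phi.
Qed.

Theorem theorem4p4 (A B : abelian_cat) (P : A -> Prop)
    (projP : projective_class P)
    (closedP : closed_class P \/ retract_closed P)
    (R : forall X : A, cubical_resolution P X)
    (S : forall X : A, em_resolution P X) :
  exists phi : forall (T : add_functor A B) (n : nat) (X : A),
      mor (cub_derived R T n X) (em_derived S T n X),
    (forall T n X, is_iso (phi T n X)) /\
    (forall T n (X Y : A) (f : mor X Y),
       (phi T n Y ∘ cub_derived_map R T n f
        = em_derived_map S T n f ∘ phi T n X)%cat) /\
    (forall (T T' : add_functor A B) (eta : nat_trans T T') n X,
       (phi T' n X ∘ cub_derived_nt R eta n X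
        = em_derived_nt S eta n X ∘ phi T n X)%cat).
Proof.
have retP : retract_closed P by case: closedP => // /closed_class_retract.
pose N X := norm_resolution (R X) retP.
have /(_ _)/cid-/all_sig[theta thetaP] X :=
  em_lift_exists (N X) (S X) (idm X).
(* First N(TX) is identified with T(NX), then [T] is applied to the comparison map over the identity
   of [X]. *)
exists (fun T n X => homology_map (fchain_map T (theta X)) n
                     ∘ homology_map (norm_fmap (R X) T) n); split; [|split].
- move=> T n X; apply: is_iso_comp; last first.
    by apply: homology_map_iso => m; apply: norm_fmap_iso.
  (* With [psi] the comparison map in the other direction, both composites lift the identity, hence
     are homotopic to it. *)
  have [psi psiP] := em_lift_exists (S X) (N X) (idm X).
  exists (homology_map (fchain_map T psi) n).
  split; rewrite -homology_map_fcomp -(homology_map_fid T);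
    apply/homotopic_homology/homotopic_fmap/em_lift_unique => /=.
    by rewrite compA psiP comp_idl comp_idr thetaP comp_idl.
  by rewrite compA thetaP comp_idl comp_idr psiP comp_idl.
- move=> T n X Y f; rewrite /cub_derived_map.
  (* The argument works for whichever precubical lift [psi] was chosen. *)
  case: xgetP => [_ -> [psi psiP ->]|]; last first.
    have [psi psiP] := cub_lift_exists (R X) (R Y) f.
    move=> /(_ (homology_map (norm_map (fprecubical_map T psi)) n)) [].
    by exists psi.
  have [chi chiP] := em_lift_exists (S X) (S Y) f.
  rewrite (em_derived_mapE T n chiP) -compA -homology_map_comp.
  rewrite (@eq_homology_map _ _ _ _ (chain_comp (fchain_map T (norm_map psi))
     (norm_fmap (R X) T))); last exact: norm_fmap_natural.
  rewrite homology_map_comp !compA; congr (_ ∘ _).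
  rewrite -!homology_map_fcomp.
  apply/homotopic_homology/homotopic_fmap.
  (* Both ways around the square lift [f] from N(R X) to S Y, so they are homotopic. *)
  apply: (em_lift_unique (E := N X) (F := S Y)) => /=.
  rewrite !compA thetaP chiP comp_idl -[RHS]compA thetaP comp_idl.
  change (cub_aug (R Y) ∘ sinc (nsub (R Y) 0) ∘ norm_map_comp psi 0
          = f ∘ (cub_aug (R X) ∘ sinc (nsub (R X) 0))).
  by rewrite -[LHS]compA norm_map_compP !compA psiP.
- move=> T T' eta n X; rewrite -compA -homology_map_comp.
  rewrite (@eq_homology_map _ _ _ _ (chain_comp (nt_chain_map eta (N X))
     (norm_fmap (R X) T))); last exact: norm_fmap_nt.
  rewrite homology_map_comp !compA; congr (_ ∘ _).
  (* This square commutes strictly, by naturality of [eta] at the components of [theta X]. *)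
  by rewrite -!homology_map_comp; apply: eq_homology_map; rewrite /= ntP.
Qed.
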